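(* Let $m\ge0$ be an integer and let $\alpha>m-1$ be real. Then, as $n\to\infty$, $$n^{-\alpha-1}\,L^{\mathrm{II}(\alpha)}_{m,n}(z/n)\;\longrightarrow\;-\binom{m-1-\alpha}{m}\,z^{-\alpha/2}J_\alpha(2\sqrt z)$$ uniformly for $z$ in compact subsets of $\mathbb{C}$.
   Context: For real $\alpha$ and integer $n\ge 0$, $L^{(\alpha)}_n(z)=\sum_{k=0}^n \binom{n+\alpha}{n-k}\frac{(-z)^k}{k!}$ is the classical Laguerre polynomial, $\binom{x}{k}=x(x-1)\cdots(x-k+1)/k!$ for real $x$, and $L^{(\alpha)}_{-1}:=0$. Put $\eta_{\alpha,m}(z)=L^{(-\alpha)}_m(z)$ and $A^{\mathrm{II}}_{\alpha,m}[y]=z\,\eta_{\alpha,m}\,y'+(\alpha-m)\,\eta_{\alpha+1,m}\,y$. For $n\ge m\ge0$ and $j=n-m$, the degree $n$ type II exceptional Laguerre polynomial is $L^{\mathrm{II}(\alpha)}_{m,n}=-A^{\mathrm{II}}_{\alpha+1,m}\big[L^{(\alpha+1)}_{j}\big]$, i.e. $L^{\mathrm{II}(\alpha)}_{m,n}(z)=z\,L^{(-\alpha-1)}_m(z)L^{(\alpha+2)}_{j-1}(z)+(m-\alpha-1)L^{(-\alpha-2)}_m(z)L^{(\alpha+1)}_j(z)$. $J_\alpha$ is the Bessel function of the first kind; $z^{-\alpha/2}J_\alpha(2\sqrt z)$ denotes the entire function $\sum_{k\ge0}\frac{(-1)^k z^k}{k!\,\Gamma(k+\alpha+1)}$. 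*)

(* Defs.v *)
From HB Require Import structures.
From mathcomp Require Import all_boot all_order all_algebra.
From mathcomp Require Import all_classical all_reals all_analysis.
From mathcomp Require Import complex.
Set Implicit Arguments.
Unset Strict Implicit.
Unset Printing Implicit Defensive.
Import Order.TTheory GRing.Theory Num.Theory.
Import numFieldNormedType.Exports.
Local Open Scope classical_set_scope.
Local Open Scope ring_scope.

(* The topology of C given by the modulus (as an R[i]-valued norm); the library
   declares it on R[i]^o only. *)
HB.instance Definition _ (R : realType) := NormedModule.copy R[i] R[i]^o.

(* binom(x, k) = x (x - 1) ... (x - k + 1) / k! *)
Definition gbinom (R : realType) (x : R) (k : nat) : R :=
  (\prod_(i < k) (x - i%:R)) / k`!%:R.

Definition laguerre (R : realType) (a : R) (n : nat) : {poly R} :=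
  \sum_(k < n.+1) (gbinom (n%:R + a) (n - k) / k`!%:R) *: (- 'X) ^+ k.

Definition eta (R : realType) (a : R) (m : nat) : {poly R} :=
  laguerre (- a) m.

Definition AII (R : realType) (a : R) (m : nat) (y : {poly R}) : {poly R} :=
  'X * eta a m * y^`() + (a - m%:R) *: (eta (a + 1) m * y).

(* Meaningful for m <= n only: below that, n - m is truncated to 0. *)
Definition xlaguerreII (R : realType) (a : R) (m n : nat) : {poly R} :=
  - AII (a + 1) m (laguerre (a + 1) (n - m)).

Definition ceval (R : realType) (p : {poly R}) (z : R[i]) : R[i] :=
  (map_poly (real_complex R) p).[z].

(* Euler's integral; this is the Gamma function on x > 0 only. *)
Definition Gamma (R : realType) (x : R) : R :=
  (\int[lebesgue_measure]_(t in `]0, +oo[) (t `^ (x - 1) * expR (- t)))%R.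

(* The entire function z^(- a / 2) J_a(2 sqrt z), for a > -1 (so that every
   Gamma argument is positive). *)
Definition bessel_entire (R : realType) (a : R) (z : R[i]) : R[i] :=
  limn (series (fun k : nat =>
    (-1) ^+ k * z ^+ k / (k`!%:R * (Gamma (k%:R + a + 1))%:C%C))).

(* Main.v *)
(* Write [E_a(z) = z^(-a/2) J_a(2 sqrt z)]. The Mehler-Heine limit
   [n^-a L_(n-d)^(a)(z/n) -> E_a(z)], uniform on discs and insensitive to the
   fixed shift [d], is applied to the two Laguerre factors (of parameters
   [alpha + 2] and [alpha + 1]), while the polynomials [L_m(z/n)] tend to their
   values at [0]; the Bessel recurrence [(a + 1) E_(a+1) - z E_(a+2) = E_a] then
   collapses the two limits into one.

   For the Mehler-Heine limit, the [k]-th coefficient of [L_j^(a)] is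
   [binom(j + a, j) j (j - 1) .. (j - k + 1)] times that of
   [Gamma (a + 1) E_a]. The scalar [n^-a binom(j + a, j)] tends to
   [1 / Gamma (a + 1)] by Wendel's inequality
   [Gamma (y + s) <= y^s Gamma y] ([0 <= s <= 1]), and the falling factorial over
   [n^k] is within [k (d + k) / n] of [1], which the [1/k!] decay of the
   coefficients makes uniformly negligible. *)
Require Import Defs.
From mathcomp Require Import all_boot all_order all_algebra.
From mathcomp Require Import all_classical all_reals all_analysis.
From mathcomp Require Import measurable_realfun complex ring lra.
Set Implicit Arguments.
Unset Strict Implicit.
Unset Printing Implicit Defensive.
Import Order.TTheory GRing.Theory Num.Theory.
Import numFieldNormedType.Exports.
Local Open Scope classical_set_scope.
Local Open Scope ring_scope.

(** * Euler's integral and its functional equation *)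

Section Gamma.
Context {R : realType}.
Notation mu := (@lebesgue_measure R).

Definition gamma_integrand (x t : R) : R := t `^ (x - 1) * expR (- t).

(** Extended-real valued, so that the functional equation can be proved before finiteness and then
    serve to establish it. *)
Definition eGamma (x : R) : \bar R :=
  (\int[mu]_(t in `]0%R, +oo[) (gamma_integrand x t)%:E)%E.

(** Starting at [2] keeps every segment nondegenerate, as the fundamental theorem of calculus
    requires. *)
Definition exhaust (i : nat) : set R := `[i.+2%:R^-1, i.+2%:R]%classic.

Lemma gamma_integrand_ge0 x t : 0 <= gamma_integrand x t.
Proof. by rewrite mulr_ge0 ?powR_ge0 ?expR_ge0. Qed.

Lemma is_derive_gamma_integrand (x t : R) : 0 < t ->
  is_derive t 1 (gamma_integrand (x + 1))
    (x * gamma_integrand x t - gamma_integrand (x + 1) t).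
Proof.
move=> t0; rewrite /gamma_integrand addrK.
have := is_derive1_powR x t0 => dp.
have de : is_derive t 1 (fun t => expR (- t) : R) (- expR (- t)).
  by apply: is_derive_eq; rewrite /GRing.scale/= mulrN1.
apply: is_derive_eq (is_deriveM dp de) _.
rewrite /GRing.scale/=; ring.
Qed.

Lemma continuous_gamma_integrand (x t : R) : 0 < t ->
  {for t, continuous (gamma_integrand x)}.
Proof.
move=> t0; have [] := is_derive_gamma_integrand (x - 1) t0.
by rewrite subrK => /derivable1_diffP/differentiable_continuous.
Qed.

Lemma measurable_gamma_integrand (x : R) :
  measurable_fun (`]0, +oo[ : set R) (gamma_integrand x).
Proof.
apply: open_continuous_measurable_fun => //.
by move=> t; rewrite inE/= in_itv/= andbT => t0; exact: continuous_gamma_integrand.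
Qed.

Lemma exhaust_sub i : exhaust i `<=` `]0, +oo[.
Proof.
move=> t; rewrite /exhaust/= !in_itv/= andbT => /andP[+ _].
by apply: lt_le_trans; rewrite invr_gt0.
Qed.

Lemma measurable_exhaust i (x : R) :
  measurable_fun (exhaust i) (gamma_integrand x).
Proof.
apply: measurable_funS (measurable_gamma_integrand x) => //.
exact: exhaust_sub.
Qed.

Lemma bigcup_exhaust : \bigcup_i exhaust i = `]0, +oo[%classic.
Proof.
apply/seteqP; split => [t [i _]|t]; first exact: exhaust_sub.
rewrite /= in_itv/= andbT => t0.
exists (Num.trunc t + Num.trunc t^-1)%N => //; rewrite /exhaust/= in_itv/=.
have h1 := truncnS_gt t; have h2 := truncnS_gt t^-1.
apply/andP; split.
  rewrite -[leRHS]invrK lef_pV2 ?posrE ?invr_gt0//.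
  by apply/ltW/(lt_le_trans h2); rewrite ler_nat ltnS leqW ?leq_addl.
by apply/ltW/(lt_le_trans h1); rewrite ler_nat ltnS leqW ?leq_addr.
Qed.

Lemma nondecreasing_exhaust : nondecreasing_seq exhaust.
Proof.
move=> i j ij; apply/subsetPset => t; rewrite /exhaust/= !in_itv/= => /andP[a b].
apply/andP; split; last by apply: (le_trans b); rewrite ler_nat !ltnS.
by apply: le_trans a; rewrite lef_pV2 ?posrE// ler_nat !ltnS.
Qed.

Lemma cvg_exhaust (x : R) :
  (\int[mu]_(t in exhaust i) (gamma_integrand x t)%:E)%E @[i --> \oo] --> eGamma x.
Proof.
rewrite /eGamma -bigcup_exhaust; apply: ge0_nondecreasing_set_cvg_integral => //.
- exact: nondecreasing_exhaust.
- by move=> i; exact: measurable_itv.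
- by move=> i; apply/measurable_EFinP; exact: measurable_exhaust.
- by move=> i t _; rewrite lee_fin gamma_integrand_ge0.
Qed.

Lemma exhaust_integrable i x :
  mu.-integrable (exhaust i) (EFin \o gamma_integrand x).
Proof.
apply: continuous_compact_integrable; first exact: segment_compact.
apply: derivable_within_continuous => t /exhaust_sub/=; rewrite in_itv/= andbT => t0.
have := is_derive_gamma_integrand (x - 1) t0.
by rewrite subrK => /@ex_derive.
Qed.

(** Integration by parts: the derivative of [t^x e^(-t)] is integrated over the segment, and only
    the boundary values stand between this and the functional equation. *)
Lemma exhaust_recurrence i x :
  \int[mu]_(t in exhaust i) gamma_integrand (x + 1) t =
  x * (\int[mu]_(t in exhaust i) gamma_integrand x t) +
  (gamma_integrand (x + 1) i.+2%:R^-1 - gamma_integrand (x + 1) i.+2%:R).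
Proof.
have ab : i.+2%:R^-1 < i.+2%:R :> R.
  by apply: (@lt_trans _ _ 1); rewrite ?invf_lt1// ltr1n.
have pos (t : R) : t \in `[i.+2%:R^-1, i.+2%:R] -> 0 < t.
  by move=> /(@exhaust_sub i t)/=; rewrite in_itv/= andbT.
have der t : 0 < t -> derivable (gamma_integrand (x + 1)) t 1.
  by move=> t0; have [] := is_derive_gamma_integrand x t0.
have := @continuous_FTC2 R
  (fun t => x * gamma_integrand x t - gamma_integrand (x + 1) t)
  (gamma_integrand (x + 1)) _ _ ab.
have H : \int[mu]_(t in exhaust i)
    (x * gamma_integrand x t - gamma_integrand (x + 1) t) =
  x * (\int[mu]_(t in exhaust i) gamma_integrand x t) -
  \int[mu]_(t in exhaust i) gamma_integrand (x + 1) t.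
  rewrite RintegralB ?RintegralZl//; try exact: exhaust_integrable.
  - exact: measurable_itv.
  - exact: measurable_itv.
  - have -> : EFin \o (fun t => x * gamma_integrand x t) =
      (fun t => x%:E * (EFin \o gamma_integrand x) t)%E by [].
    by apply: integrableZl; [exact: measurable_itv|exact: exhaust_integrable].
move=> FTC; move: H; rewrite /Rintegral FTC/=.
- by move=> H; lra.
- apply: derivable_within_continuous => t /pos t0.
  apply: derivableB; last exact: der.
  apply: derivableM => //.
  by have := is_derive_gamma_integrand (x - 1) t0; rewrite subrK => /@ex_derive.
- split.
  + by move=> t /subset_itv_oo_cc/pos; exact: der.
  + apply: cvg_at_right_filter; apply: continuous_gamma_integrand.
    by rewrite invr_gt0.
  + by apply: cvg_at_left_filter; exact: continuous_gamma_integrand.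
- move=> t /subset_itv_oo_cc/pos t0; rewrite derive1E.
  by have [_ ->] := is_derive_gamma_integrand x t0.
Qed.

Lemma cvg_harmonic2 : (i.+2%:R^-1 : R) @[i --> \oo] --> 0.
Proof.
have := @cvg_harmonic R.
by rewrite -(cvg_shiftS (@harmonic R)).
Qed.

Lemma cvg_gamma_integrand0 x : 0 < x ->
  gamma_integrand (x + 1) i.+2%:R^-1 @[i --> \oo] --> 0.
Proof.
move=> x0.
have h : (i.+2%:R^-1 : R) `^ x @[i --> \oo] --> 0.
  have /cvg_at_rightP := powR_cvg0 x0; apply; split => //.
  exact: cvg_harmonic2.
apply: (@squeeze_cvgr _ _ _ _ (cst 0) (fun i : nat => (i.+2%:R^-1 : R) `^ x)) => //;
  last exact: cvg_cst.
near=> i; rewrite gamma_integrand_ge0/= /gamma_integrand addrK.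
by rewrite ler_piMr ?powR_ge0// -expR0 ler_expR oppr_le0 invr_ge0.
Unshelve. all: by end_near. Qed.

(** With [x - 1 <= n + 1], the bound [e^b >= b^(n+2) / (n+2)!] makes the integrand at [b] at most
    [(n+2)! / b]. *)
Lemma cvg_gamma_integrandy x :
  gamma_integrand x i.+2%:R @[i --> \oo] --> 0.
Proof.
pose n := Num.trunc `|x - 1|.
have xn : x - 1 <= n.+1%:R by rewrite (le_trans (ler_norm _))// ltW// truncnS_gt.
apply: (@squeeze_cvgr _ _ _ _ (cst 0) (fun i : nat => n.+2`!%:R * i.+2%:R^-1 : R)).
- near=> i; rewrite gamma_integrand_ge0/= /gamma_integrand.
  have b0 : 0 < i.+2%:R :> R by [].
  rewrite expRN ler_pdivrMr ?expR_gt0//.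
  apply: (@le_trans _ _ (i.+2%:R ^+ n.+1)).
    by rewrite -powR_mulrn// ler_powR// ler1n.
  have := expR_ge1Dxn n.+1 (ltW b0) => h.
  have {h} h : i.+2%:R ^+ n.+2 / n.+2`!%:R <= expR i.+2%:R :> R by lra.
  have c0 : 0 <= n.+2`!%:R * i.+2%:R^-1 :> R by rewrite divr_ge0.
  apply: le_trans (ler_wpM2l c0 h).
  have f0 : n.+2`!%:R != 0 :> R by rewrite pnatr_eq0 -lt0n fact_gt0.
  move: (n.+2`!%:R) f0 (i.+2%:R) b0 => /= c c1 b /lt0r_neq0 b1.
  by rewrite [b ^+ n.+2]exprS (_ : c * b^-1 * _ = b ^+ n.+1)//; field; rewrite b1 c1.
- exact: cvg_cst.
- rewrite -[X in _ --> X](mulr0 n.+2`!%:R); apply: cvgMr.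
  exact: cvg_harmonic2.
Unshelve. all: by end_near. Qed.

(** Limit of [exhaust_recurrence] by monotone convergence; [0 < x] is what kills the boundary term
    at the origin. *)
Lemma eGammaD1 x : 0 < x -> eGamma (x + 1) = (x%:E * eGamma x)%E.
Proof.
move=> x0.
have fin y i : (\int[mu]_(t in exhaust i) (gamma_integrand y t)%:E =
    (\int[mu]_(t in exhaust i) gamma_integrand y t)%:E)%E.
  by rewrite /Rintegral fineK//; apply: integrable_fin_num;
    [exact: measurable_itv|exact: exhaust_integrable].
rewrite -(cvg_lim _ (@cvg_exhaust (x + 1)))//; apply: cvg_lim => //; rewrite -[(x%:E * _)%E]adde0.
under eq_fun do rewrite fin exhaust_recurrence EFinD EFinM -fin.
apply: cvgeD.
- by rewrite fin_num_adde_defl.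
- by apply: cvgeZl => //; exact: cvg_exhaust.
apply: cvg_EFin; first by near=> i.
rewrite -[X in _ --> X](subr0 0).
by apply: cvgB; [exact: cvg_gamma_integrand0|exact: cvg_gamma_integrandy].
Unshelve. all: by end_near. Qed.

End Gamma.

(** * Finiteness and positivity of Gamma, and Wendel's inequality *)

Section GammaFun.
Context {R : realType}.
Notation mu := (@lebesgue_measure R).

Lemma eGamma_ge0 (x : R) : (0 <= eGamma x)%E.
Proof. by apply: integral_ge0 => t _; rewrite lee_fin gamma_integrand_ge0. Qed.

Lemma eGamma1 : eGamma 1 = 1%E :> \bar R.
Proof.
have E t : gamma_integrand 1 t = expR (- t) :> R.
  by rewrite /gamma_integrand subrr powRr0 mul1r.
rewrite /eGamma integral_itv_obnd_cbnd; last first.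
  by apply/measurable_EFinP; exact: measurable_gamma_integrand.
under eq_integral do rewrite E.
have dF (t : R) : is_derive t 1 (fun t => - expR (- t) : R) (expR (- t)).
  by apply: is_derive_eq; rewrite /GRing.scale/= mulrN1 opprK.
have cF (t : R) : {for t, continuous (fun t => - expR (- t) : R)}.
  by have [/derivable1_diffP/differentiable_continuous] := dF t.
have cf (t : R) : {for t, continuous (fun t => expR (- t) : R)}.
  apply: continuous_comp; last exact: continuous_expR.
  exact: opp_continuous.
rewrite (@ge0_continuous_FTC2y R _ (fun t => - expR (- t)) 0 0).
- by rewrite oppr0 expR0 sub0e -EFinN opprK.
- by move=> t _; exact: expR_ge0.
- by apply: continuous_subspaceT => t; exact: cf.
- by rewrite -[X in _ --> X]oppr0; apply: cvgN; exact: cvgr_expR.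
- by move=> t _; have [] := dF t.
- by apply: cvg_at_right_filter; exact: cF.
- by move=> t _; rewrite derive1E; have [_ ->] := dF t.
Qed.

Lemma eGammaS n : eGamma n.+1%:R = (n`!%:R)%:E :> \bar R.
Proof.
elim: n => [|n IH]; first by rewrite eGamma1.
by rewrite -natr1 eGammaD1// IH -EFinM -natrM -factS.
Qed.

(** By the functional equation it is enough to treat [x + 1], which avoids the singularity at the
    origin: there [t^x <= 1 + t^(n+1)] with [x <= n + 1], and Gamma is finite at the integers [1]
    and [n + 2]. *)
Lemma eGamma_fin_num (x : R) : 0 < x -> eGamma x \is a fin_num.
Proof.
move=> x0; rewrite ge0_fin_numE ?eGamma_ge0//.
suff : (eGamma (x + 1) < +oo)%E.
  rewrite eGammaD1//; have := eGamma_ge0 x.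
  by case: (eGamma x) => [r _ _| |]//; rewrite ?ltry// gt0_muley// ltxx.
pose n := Num.trunc x.
have xn : x <= n.+1%:R by rewrite ltW// truncnS_gt.
apply: (@le_lt_trans _ _ (eGamma 1 + eGamma n.+2%:R)%E); last first.
  by rewrite eGamma1 eGammaS -EFinD ltry.
rewrite /eGamma -ge0_integralD//=; last 4 first.
- by move=> t _; rewrite lee_fin gamma_integrand_ge0.
- by apply/measurable_EFinP; exact: measurable_gamma_integrand.
- by move=> t _; rewrite lee_fin gamma_integrand_ge0.
- by apply/measurable_EFinP; exact: measurable_gamma_integrand.
apply: ge0_le_integral => //=.
- by move=> t _; rewrite lee_fin gamma_integrand_ge0.
- by apply/measurable_EFinP; exact: measurable_gamma_integrand.
- apply/(@measurable_EFinP _ _ _ _ (gamma_integrand 1 \+ gamma_integrand n.+2%:R)).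
  by apply: measurable_funD; exact: measurable_gamma_integrand.
move=> t; rewrite in_itv/= andbT => t0.
rewrite -EFinD lee_fin /gamma_integrand -mulrDl ler_wpM2r ?expR_ge0//.
rewrite subrr powRr0 addrK -[n.+2%:R]natr1 addrK.
have [t1|/ltW t1] := leP t 1.
  rewrite ler_wpDr ?powR_ge0//.
  by rewrite -(powRr0 t) ger_powR// ?t0// ltW.
by rewrite ler_wpDl// ler_powR.
Qed.

Lemma GammaE (x : R) : Gamma x = fine (eGamma x).
Proof. by []. Qed.

Lemma Gamma_ge0 (x : R) : 0 <= Gamma x.
Proof. by rewrite GammaE fine_ge0// eGamma_ge0. Qed.

Lemma gamma_integrable (x : R) : 0 < x ->
  mu.-integrable `]0, +oo[ (EFin \o gamma_integrand x).
Proof.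
move=> x0; apply/integrableP; split.
  by apply/measurable_EFinP; exact: measurable_gamma_integrand.
under eq_integral do rewrite gee0_abs ?lee_fin ?gamma_integrand_ge0//.
by have := eGamma_fin_num x0; rewrite ge0_fin_numE ?eGamma_ge0.
Qed.

Lemma GammaD1 (x : R) : 0 < x -> Gamma (x + 1) = x * Gamma x.
Proof. by move=> x0; rewrite !GammaE eGammaD1// fineM// eGamma_fin_num. Qed.

Lemma GammaS n : Gamma n.+1%:R = n`!%:R :> R.
Proof. by rewrite GammaE eGammaS. Qed.

(** Weighted arithmetic-geometric mean inequality for [1] and [u]. With [w] the arithmetic mean,
    [ln v <= v - 1] is applied at [v = 1 / w] and [v = u / w]; the right-hand sides, weighted by
    [1 - s] and [s], add up to [0]. *)
Lemma powR_le_tangent (u s : R) : 0 < u -> 0 <= s <= 1 ->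
  u `^ s <= 1 - s + s * u.
Proof.
move=> u0 /andP[s0 s1]; set w := 1 - s + s * u.
have w0 : 0 < w.
  rewrite /w; move: s0; rewrite le_eqVlt => /predU1P[<-|s0].
    by rewrite subr0 mul0r addr0.
  by rewrite ltr_wpDl ?subr_ge0// mulr_gt0.
have lnB (v : R) : 0 < v -> ln v <= v - 1.
  by move=> v0; rewrite lerBrDl -[leRHS]lnK// expR_ge1Dx.
rewrite -[leRHS]lnK// /powR gt_eqF// ler_expR -subr_le0.
have h1 := lnB _ (divr_gt0 (@ltr01 R) w0).
have h2 := lnB _ (divr_gt0 u0 w0).
rewrite ln_div ?posrE// ln1 sub0r in h1; rewrite ln_div ?posrE// in h2.
have -> : s * ln u - ln w = (1 - s) * (- ln w) + s * (ln u - ln w) by ring.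
have -> : 0 = (1 - s) * (1 / w - 1) + s * (u / w - 1).
  by rewrite /w in w0 *; field; rewrite gt_eqF.
by rewrite lerD// ler_wpM2l// subr_ge0.
Qed.

(* Wendel's inequality: integrate [(t / y)^s <= 1 - s + s t / y] against
   [y^s t^(y-1) e^(-t)]. *)
Lemma Gamma_wendel (y s : R) : 0 < y -> 0 <= s <= 1 ->
  Gamma (y + s) <= y `^ s * Gamma y.
Proof.
move=> y0 s01; have [s0 s1] := andP s01.
have -> : y `^ s * Gamma y =
    y `^ s * ((1 - s) * Gamma y + s / y * Gamma (y + 1)).
  by rewrite GammaD1//; congr (_ * _); field; rewrite gt_eqF.
have ys0 : 0 < y + s by rewrite ltr_wpDr.
have y10 : 0 < y + 1 by rewrite ltr_wpDr.
have iZ k z : 0 < z ->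
    mu.-integrable `]0, +oo[ (EFin \o (fun t => k * gamma_integrand z t)).
  move=> z0; have -> : EFin \o (fun t => k * gamma_integrand z t) =
    (fun t => k%:E * (EFin \o gamma_integrand z) t)%E by [].
  by apply: integrableZl; [exact: measurable_itv|exact: gamma_integrable].
have D : Gamma (y + s) = \int[mu]_(t in `]0, +oo[) gamma_integrand (y + s) t by [].
have -> : y `^ s * ((1 - s) * Gamma y + s / y * Gamma (y + 1)) =
  \int[mu]_(t in `]0, +oo[)
    (y `^ s * (1 - s) * gamma_integrand y t + y `^ s * (s / y) * gamma_integrand (y + 1) t).
  rewrite RintegralD; [|exact: measurable_itv|exact: iZ|exact: iZ].
  rewrite !RintegralZl; try exact: measurable_itv; try exact: gamma_integrable.
  by rewrite /Gamma /gamma_integrand; ring.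
rewrite D; apply: le_Rintegral.
- exact: measurable_itv.
- exact: gamma_integrable.
- apply: (integrableD _ (iZ (y `^ s * (1 - s)) _ y0) (iZ (y `^ s * (s / y)) _ y10)).
  exact: measurable_itv.
move=> t; rewrite /= in_itv/= andbT => t0.
have ty : 0 < t / y by rewrite divr_gt0.
have tn0 : t != 0 by rewrite gt_eqF.
have e1 : gamma_integrand (y + s) t = y `^ s * (t / y) `^ s * gamma_integrand y t.
  rewrite /gamma_integrand -powRM ?(ltW y0) ?(ltW ty)// [y * _]mulrC divfK ?gt_eqF//.
  by rewrite mulrA -powRD ?tn0 ?implybT//; congr (_ `^ _ * _); ring.
have e2 : gamma_integrand (y + 1) t = t * gamma_integrand y t.
  rewrite /gamma_integrand mulrA; congr (_ * _).
  by rewrite addrK mulr_powRB1// ltW.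
rewrite e1 e2.
have -> : y `^ s * (1 - s) * gamma_integrand y t +
    y `^ s * (s / y) * (t * gamma_integrand y t) =
  y `^ s * (1 - s + s * (t / y)) * gamma_integrand y t by ring.
rewrite ler_wpM2r ?gamma_integrand_ge0// ler_wpM2l ?powR_ge0//.
exact: powR_le_tangent.
Qed.

(** If Gamma vanished at [x] it would vanish at [x + 1], and Wendel's inequality from [x + 1] up to
    the integer [n + 2] would force [(n + 1)! <= 0]. *)
Lemma Gamma_gt0 (x : R) : 0 < x -> 0 < Gamma x.
Proof.
move=> x0; rewrite lt_neqAle Gamma_ge0 andbT; apply/negP => /eqP Gx0.
pose n := Num.trunc x.
have /andP[nx xn] : n%:R <= x < n.+1%:R by apply: truncn_itv; exact: ltW.
have := @Gamma_wendel (x + 1) (n.+1%:R - x) (ltr_wpDr ler01 x0).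
rewrite GammaD1// -Gx0 !mulr0 (_ : x + 1 + (n.+1%:R - x) = n.+2%:R); last first.
  by rewrite -[n.+2%:R]natr1; ring.
rewrite GammaS => H; have : n.+1`!%:R <= 0 :> R.
  apply: H; rewrite subr_ge0 (ltW xn)/= lerBlDr -nat1r lerD2l//.
by rewrite leNgt ltr0n fact_gt0.
Qed.

End GammaFun.

(** * Growth of Gamma quotients and of [binom(n + a, n)] *)

Section Asymptotics.
Context {R : realType}.

Definition rising (x : R) (k : nat) : R := \prod_(i < k) (x + i%:R).

Lemma rising_gt0 (x : R) k : 0 < x -> 0 < rising x k.
Proof. by move=> x0; apply: prodr_gt0 => i _; rewrite ltr_wpDr. Qed.

Lemma Gamma_rising (x : R) k : 0 < x -> Gamma (k%:R + x) = rising x k * Gamma x.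
Proof.
move=> x0; elim: k => [|k IH]; first by rewrite /rising big_ord0 add0r mul1r.
rewrite -natr1 addrAC GammaD1 ?ltr_wpDl// IH /rising big_ord_recr/=.
by rewrite mulrCA mulrA [k%:R + x]addrC.
Qed.

Lemma gbinom_rising (a : R) n : gbinom (n%:R + a) n = rising (a + 1) n / n`!%:R.
Proof.
rewrite /gbinom /rising (reindex_inj rev_ord_inj)/=; congr (_ / _).
apply: eq_bigr => i _; rewrite natrB// -natr1; ring.
Qed.

Lemma gbinom_Gamma (a : R) n : 0 < a + 1 ->
  gbinom (n%:R + a) n = Gamma (n.+1%:R + a) / n`!%:R / Gamma (a + 1).
Proof.
move=> a0; rewrite gbinom_rising -natr1 -addrA [1 + a]addrC Gamma_rising//.
by rewrite mulrAC mulfK// gt_eqF// Gamma_gt0.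
Qed.

Lemma cvg_harmonicM (c : R) : 1 + c * n.+1%:R^-1 @[n --> \oo] --> (1 : R).
Proof.
rewrite -[X in _ --> X]addr0 -[X in _ --> _ + X](mulr0 c).
by apply: cvgD; [exact: cvg_cst|apply: cvgMr; exact: cvg_harmonic].
Qed.

(** The fractional part [s] of [a] is handled by squeezing with Wendel's inequality, the integer
    part by induction through the functional equation. *)
Lemma cvg_Gamma_ratio (a : R) : 0 <= a ->
  Gamma (n.+1%:R + a) / n`!%:R / n.+1%:R `^ a @[n --> \oo] --> (1 : R).
Proof.
pose s := a - (Num.trunc a)%:R; move=> a0.
have /andP[ta at1] : (Num.trunc a)%:R <= a < (Num.trunc a).+1%:R by apply: truncn_itv.
have s0 : 0 <= s by rewrite subr_ge0.
have s1 : s <= 1 by rewrite /s; move: at1; rewrite -nat1r; lra.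
have -> : a = s + (Num.trunc a)%:R by rewrite subrK.
clearbody s; elim: (Num.trunc a) => [|k IH].
  rewrite addr0.
  apply: (@squeeze_cvgr _ _ _ _ (fun n : nat => (1 + 1 * n.+1%:R^-1)^-1) (cst 1)).
  - near=> n; have n0 : 0 < n.+1%:R :> R by [].
    have f0 : 0 < n`!%:R :> R by rewrite ltr0n fact_gt0.
    have ns0 : 0 < n.+1%:R + s by rewrite ltr_wpDr.
    apply/andP; split; last first.
      rewrite ler_pdivrMr ?powR_gt0// mul1r ler_pdivrMr// -GammaS.
      by apply: Gamma_wendel => //; rewrite s0.
    (* The lower bound is Wendel's inequality again, now from [n + 1 + s] up to [n + 2]. It bounds
       the ratio below by [u^(1-s)], hence by [u] because [u <= 1]. *)
    have := @Gamma_wendel R (n.+1%:R + s) (1 - s) ns0.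
    rewrite subr_ge0 s1 lerBlDr lerDl s0 => /(_ isT).
    rewrite (_ : n.+1%:R + s + (1 - s) = n.+2%:R); last by rewrite -[n.+2%:R]natr1; ring.
    rewrite GammaS factS natrM => H.
    set u := n.+1%:R / (n.+1%:R + s).
    have u01 : 0 < u <= 1.
      by rewrite divr_gt0//= ler_pdivrMr// mul1r lerDl.
    apply: (@le_trans _ _ u).
      rewrite /u -[leRHS]invrK lef_pV2 ?posrE ?invr_gt0 ?divr_gt0 ?ltr_wpDr ?mulr_ge0//.
      by rewrite invf_div mulrDl divff ?gt_eqF// lerD2l ler_wpM2r// invr_ge0.
    apply: (@le_trans _ _ (u `^ (1 - s))).
      by rewrite ger1_powR// lerBlDr lerDl.
    have -> : u `^ (1 - s) = n.+1%:R / n.+1%:R `^ s / (n.+1%:R + s) `^ (1 - s).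
      rewrite /u powRM ?invr_ge0 ?(ltW ns0)// -powR_inv1 ?(ltW ns0)//.
      rewrite -powRrM mulN1r powRN; congr (_ / _).
      by rewrite powRB ?powRr1 ?(ltW n0)// (gt_eqF n0) implybT.
    rewrite ler_pdivrMr ?powR_gt0// [leRHS]mulrAC.
    rewrite ler_wpM2r ?invr_ge0 ?powR_ge0//.
    rewrite [leRHS]mulrAC.
    rewrite (ler_pdivlMr _ _ f0).
    by rewrite [leRHS]mulrC.
  - by have := cvgV (oner_neq0 R) (cvg_harmonicM 1); rewrite invr1; apply.
  - exact: cvg_cst.
(* Raising the parameter by one multiplies the ratio by [(n + 1 + s + k) / (n + 1)]. *)
have := cvgM (cvg_harmonicM (s + k%:R)) IH.
rewrite mulr1 => /(_ _) H; apply: cvg_trans H.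
apply: near_eq_cvg; near=> n => /=.
have n0 : n.+1%:R != 0 :> R by [].
have p0 : n.+1%:R `^ (s + k%:R) != 0 :> R by rewrite gt_eqF ?powR_gt0.
rewrite -[k.+1%:R]natr1 !addrA GammaD1 ?ltr_wpDr//.
rewrite [n.+1%:R `^ (s + k%:R + 1)]powRD ?n0 ?implybT// powRr1//.
have f0 : n`!%:R != 0 :> R by rewrite pnatr_eq0 -lt0n fact_gt0.
move: (Gamma _) (n`!%:R) f0 (_ `^ _) p0 => G f f0 p p0.
by field; rewrite p0 f0 nat1r n0.
Unshelve. all: by end_near. Qed.

Lemma cvg_gbinom (a : R) d : 0 <= a ->
  n%:R `^ (- a) * gbinom ((n - d)%:R + a) (n - d) @[n --> \oo] --> (Gamma (a + 1))^-1.
Proof.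
move=> a0; rewrite -(cvg_shiftn d)/=.
(* After the shift by [d], the base is [(n + d) / (n + 1)]: this factor turns the normalisation by
   [(n + 1)^a] into the wanted one by [(n + d)^a]. *)
have c1 : (1 + (d%:R - 1) * n.+1%:R^-1) `^ (- a) @[n --> \oo] --> (1 : R).
  have [/derivable1_diffP/differentiable_continuous H _] :=
    is_derive1_powR (- a) (@ltr01 R).
  by have := continuous_cvg _ H (cvg_harmonicM (d%:R - 1)); rewrite powR1; apply.
have := cvgM c1 (cvg_Gamma_ratio a0).
rewrite mulr1 => /(_ _)/(@cvgMl _ _ _ _ _ _ (Gamma (a + 1))^-1) H.
rewrite mul1r in H; apply: cvg_trans H.
apply: near_eq_cvg; near=> n => /=.
rewrite addnK gbinom_Gamma ?ltr_wpDl// (natrD _ n d).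
have -> : 1 + (d%:R - 1) / n.+1%:R = (n%:R + d%:R) / n.+1%:R :> R.
  by rewrite -natr1; field; rewrite natr1.
rewrite powRM ?invr_ge0 ?addr_ge0// -[n.+1%:R^-1]powR_inv1// -powRrM mulN1r opprK.
have p0 : n.+1%:R `^ a != 0 :> R by rewrite gt_eqF ?powR_gt0.
move: (_ `^ _) p0 (_ `^ _) (_`!%:R^-1) (Gamma (a + 1))^-1 (Gamma _) => p p0 u f g G.
by field.
Unshelve. all: by end_near. Qed.
End Asymptotics.

(** * Laguerre coefficients, values at [0], and the coefficient form of the Bessel recurrence *)

Section Laguerre.
Context {R : realType}.

(* [(-1)^k / (k! (a + 1)_k)], i.e. [Gamma (a + 1)] times the coefficients of
   the entire function [z^(-a/2) J_a(2 sqrt z)]. *)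
Definition bessel_coef (a : R) (k : nat) : R :=
  (-1) ^+ k / (k`!%:R * rising (a + 1) k).

(** Lowering the lower index from [n - k] by one removes the factor [a + 1 + k] from the numerator
    and [n - k] from the factorial. This splits the Laguerre coefficient into a scalar, a falling
    factorial, and a part free of [n]. *)
Lemma gbinomB (a : R) n k : 0 < a + 1 -> (k <= n)%N ->
  gbinom (n%:R + a) (n - k) =
  gbinom (n%:R + a) n * (n ^_ k)%:R / rising (a + 1) k.
Proof.
move=> a0; elim: k => [_|k IH kn].
  by rewrite subn0 ffactn0 mulr1 /rising big_ord0 divr1.
have r0 := lt0r_neq0 (rising_gt0 k a0).
have rS : a + 1 + k%:R != 0 by rewrite gt_eqF// ltr_wpDr.
rewrite [rising _ _]big_ord_recr/= -/(rising (a + 1) k) ffactnSr natrM.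
have E : gbinom (n%:R + a) (n - k) * (n - k)%:R =
    gbinom (n%:R + a) (n - k.+1) * (a + 1 + k%:R).
  rewrite /gbinom -(subnSK kn) big_ord_recr/= factS natrM.
  have f0 : (n - k.+1)`!%:R != 0 :> R by rewrite pnatr_eq0 -lt0n fact_gt0.
  have -> : n%:R + a - (n - k.+1)%:R = a + 1 + k%:R.
    by rewrite natrB// -[k.+1%:R]natr1; ring.
  have m0 : (n - k.+1).+1%:R != 0 :> R by [].
  move: ((n - k.+1)`!%:R) f0 ((n - k.+1).+1%:R) m0 (\prod_(i < _) _) => f f0 m m0 p.
  by field; rewrite m0 f0.
move/(canLR (mulfK rS)): E => <-.
rewrite IH ?(ltnW kn)//.
move: (rising _ _) r0 (a + 1 + _) rS => r r0 s s0.
by field; rewrite s0 r0.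
Qed.

Lemma ceval_laguerre (a : R) n N z : 0 < a + 1 -> (n < N)%N ->
  ceval (laguerre a n) z = (gbinom (n%:R + a) n)%:C%C *
    \sum_(k < N) ((n ^_ k)%:R * bessel_coef a k)%:C%C * z ^+ k.
Proof.
move=> a0 nN; rewrite /ceval /laguerre rmorph_sum horner_sum.
rewrite (big_ord_widen_cond N predT (fun k : nat =>
  (map_poly (real_complex R) ((gbinom (n%:R + a) (n - k) / k`!%:R) *: (- 'X) ^+ k)).[z]))//.
rewrite big_mkcond/= mulr_sumr; apply: eq_bigr => k _.
rewrite ltnS; case: leqP => kn; last first.
  (* Terms beyond the degree vanish with [n ^_ k], so any [N > n] gives the same sum. *)
  by rewrite ffact_small// mul0r mul0r mulr0.
rewrite map_polyZ/= rmorphXn rmorphN/= map_polyX hornerZ horner_exp hornerN hornerX.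
rewrite gbinomB// exprNn [LHS]mulrA [RHS]mulrA; congr (_ * _).
rewrite -[in LHS](rmorphN1 (real_complex R)) -[in LHS](rmorphXn (real_complex R)).
rewrite -!rmorphM/=; congr (_%:C)%C; rewrite /bessel_coef.
by field; rewrite pnatr_eq0 -lt0n fact_gt0 (lt0r_neq0 (rising_gt0 k a0)).
Qed.

Lemma deriv_laguerreS (a : R) n :
  (laguerre a n.+1)^`() = - laguerre (a + 1) n.
Proof.
rewrite /laguerre linear_sum big_ord_recl/= derivZ expr0 derivC scaler0 add0r.
rewrite -sumrN; apply: eq_bigr => k _; rewrite /bump/= add1n subSS.
rewrite derivZ deriv_exp derivN derivX -natr1 -addrA [1 + a]addrC.
rewrite mulN1r mulNrn scalerN; congr (- _).
rewrite -[_ ^+ _ *+ _]scaler_nat scalerA; congr (_ *: _).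
rewrite factS natrM; field.
by rewrite pnatr_eq0 -lt0n fact_gt0 nat1r pnatr_eq0.
Qed.

Lemma laguerre0 (a : R) n : (laguerre a n).[0] = gbinom (n%:R + a) n.
Proof.
rewrite /laguerre horner_sum big_ord_recl big1 ?addr0 => [|k _].
  by rewrite hornerZ expr0 hornerC fact0 divr1 mulr1 subn0.
by rewrite hornerZ horner_exp hornerN hornerX oppr0 expr0n mulr0.
Qed.

Lemma ceval_xlaguerreII (a : R) m n z : (m < n)%N ->
  ceval (xlaguerreII a m n) z =
    z * ceval (laguerre (- a - 1) m) z * ceval (laguerre (a + 2) (n - m.+1)) z +
    (m%:R - a - 1)%:C%C * ceval (laguerre (- a - 2) m) z *
      ceval (laguerre (a + 1) (n - m)) z.
Proof.
(* Since [m < n], the degree [n - m] is a successor and the derivative formula applies; its sign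
   cancels the one in front of [AII]. *)
move=> mn; rewrite /xlaguerreII /AII /eta -(subnSK mn) deriv_laguerreS.
have -> : - (a + 1) = - a - 1 by ring.
have -> : - (a + 1 + 1) = - a - 2 by ring.
have -> : a + 1 + 1 = a + 2 by ring.
have -> : a + 1 - m%:R = - (m%:R - a - 1) by ring.
rewrite mulrN scaleNr -opprD opprK scalerAl.
rewrite /ceval rmorphD !rmorphM/= map_polyX map_polyZ/=.
by rewrite hornerD !hornerM hornerX hornerZ.
Qed.

(** With [x = m - a - 2], both sides are [(x + 1) x ... (x + 1 - m) / m!], split at its first or at
    its last factor. It makes the values at [0] of the two degree-[m] Laguerre factors multiples of
    one binomial. *)
Lemma gbinomB1 (a : R) m :
  (m%:R - a - 1) * gbinom (m%:R + (- a - 2)) m =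
  - (a + 1) * gbinom (m%:R - 1 - a) m.
Proof.
rewrite /gbinom !mulrA; congr (_ / _).
have -> : m%:R - a - 1 = m%:R + (- a - 2) + 1 by ring.
have -> : m%:R - 1 - a = m%:R + (- a - 2) + 1 by ring.
have -> : - (a + 1) = m%:R + (- a - 2) + 1 - m%:R by ring.
move: (m%:R + (- a - 2)) => x.
transitivity (\prod_(i < m.+1) (x + 1 - i%:R)).
  rewrite big_ord_recl subr0; congr (_ * _); apply: eq_bigr => i _.
  by rewrite lift0 -natr1; ring.
by rewrite big_ord_recr/= mulrC.
Qed.

(** The coefficient of [z^(k+1)] in the Bessel recurrence multiplied by [Gamma (a + 1)]; the
    denominator is [Gamma (a + 3) / Gamma (a + 1)]. *)
Lemma bessel_coef_recurrence (a : R) k : 0 < a + 1 ->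
  bessel_coef (a + 1) k.+1 - bessel_coef a k.+1 =
  bessel_coef (a + 2) k / ((a + 1) * (a + 2)).
Proof.
move=> a0.
have rl x n : rising x n.+1 = x * rising (x + 1) n :> R.
  rewrite /rising big_ord_recl addr0; congr (_ * _).
  by apply: eq_bigr => i _; rewrite lift0 -nat1r addrA.
have rr x n : rising x n.+1 = rising x n * (x + n%:R) :> R.
  by rewrite /rising big_ord_recr.
rewrite /bessel_coef [rising (a + 1) _]rl rl factS natrM.
have -> : a + 2 + 1 = a + 1 + 1 + 1 by ring.
have r0 : rising (a + 1 + 1 + 1) k != 0.
  by apply: lt0r_neq0; apply: rising_gt0; do 2 rewrite ltr_wpDr//.
have f0 : k`!%:R != 0 :> R by rewrite pnatr_eq0 -lt0n fact_gt0.
(* Peeling [rising (a + 2) k.+1] at either end expresses every product through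
   [rising (a + 3) k]. *)
have E : rising (a + 1 + 1) k * (a + 1 + 1 + k%:R) = (a + 1 + 1) * rising (a + 1 + 1 + 1) k.
  by rewrite -rl rr.
rewrite -(mulfK (_ : a + 1 + 1 + k%:R != 0) (rising (a + 1 + 1) k)) ?E; last first.
  by rewrite gt_eqF// ltr_wpDr// ltr_wpDr.
rewrite exprS; field; rewrite r0 f0 nat1r pnatr_eq0/=.
by rewrite !gt_eqF//; lra || (rewrite ltr_wpDr//; lra).
Qed.

End Laguerre.

(** * Real-valued modulus, dominated complex series, and uniform convergence on discs *)

Section ComplexAnalysis.
Context {R : realType}.
Implicit Types z w : R[i].
Notation normc := (@Normc.normc R).

Lemma normr_normc z : `|z| = (normc z)%:C%C.
Proof. by case: z. Qed.

Lemma normc_ge0 z : 0 <= normc z.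
Proof. by case: z => a b; exact: sqrtr_ge0. Qed.

Lemma normcD z w : normc (z + w) <= normc z + normc w.
Proof. exact: (@le_normcD R). Qed.

Lemma normcN z : normc (- z) = normc z.
Proof. exact: (@normcN R). Qed.

Lemma normcB z w : normc (z - w) = normc (w - z).
Proof. by rewrite -normcN opprB. Qed.

Lemma normc_real (x : R) : normc x%:C%C = `|x|.
Proof. by rewrite /= expr0n/= addr0 sqrtr_sqr. Qed.

Lemma normcX z n : normc (z ^+ n) = normc z ^+ n.
Proof.
elim: n => [|n IH]; first by rewrite !expr0 Normc.normc1.
by rewrite !exprS Normc.normcM IH.
Qed.

Lemma normc_sum (I : Type) (r : seq I) (P : pred I) (F : I -> R[i]) :
  normc (\sum_(i <- r | P i) F i) <= \sum_(i <- r | P i) normc (F i).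
Proof.
elim/big_rec2: _ => [|i x y _ H]; first by rewrite Normc.normc0.
by apply: le_trans (normcD _ _) _; rewrite lerD2l.
Qed.

Lemma normRe_le z : `|complex.Re z| <= normc z.
Proof. by case: z => a b /=; rewrite -sqrtr_sqr ler_wsqrtr// lerDl sqr_ge0. Qed.

Lemma normIm_le z : `|complex.Im z| <= normc z.
Proof. by case: z => a b /=; rewrite -sqrtr_sqr ler_wsqrtr// lerDr sqr_ge0. Qed.

Lemma normc_le_ReIm z : normc z <= `|complex.Re z| + `|complex.Im z|.
Proof.
case: z => a b /=; rewrite -[leRHS]ger0_norm ?addr_ge0// -sqrtr_sqr.
rewrite ler_wsqrtr// sqrrD !real_normK ?num_real//.
by rewrite lerD2r lerDl mulrn_wge0// mulr_ge0.
Qed.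

(** The norm of [R[i]] takes values in [R[i]], where a positive epsilon is necessarily real; this
    lets all estimates be made in [R]. *)
Lemma cvgC_normc (T : Type) (F : set_system T) {FF : Filter F}
    (u : T -> R[i]) (l : R[i]) :
  normc (l - u x) @[x --> F] --> (0 : R) -> u x @[x --> F] --> l.
Proof.
move=> /cvgrPdist_lt H; apply/cvgrPdist_lt => e e0.
have eR : e = (complex.Re e)%:C%C by rewrite RRe_real// gtr0_real.
have e0' : 0 < complex.Re e by rewrite -ltcR -eR.
near=> x; rewrite normr_normc eR ltcR.
have : `|0 - normc (l - u x)| < complex.Re e by near: x; exact: H.
by rewrite sub0r normrN ger0_norm// normc_ge0.
Unshelve. all: by end_near. Qed.

Lemma normc_cvgC (T : Type) (F : set_system T) {FF : Filter F}
    (u : T -> R[i]) (l : R[i]) :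
  u x @[x --> F] --> l -> normc (l - u x) @[x --> F] --> (0 : R).
Proof.
move=> /cvgrPdist_lt H; apply/cvgrPdist_lt => e e0; near=> x.
rewrite sub0r normrN ger0_norm ?normc_ge0// -ltcR -normr_normc.
by near: x; apply: H; rewrite ltcR.
Unshelve. all: by end_near. Qed.

(** Real and imaginary parts are dominated by [v], hence converge absolutely; their sums are
    assembled into the complex limit. *)
Lemma is_cvg_seriesC (c : nat -> R[i]) (v : nat -> R) :
  (forall k, normc (c k) <= v k) -> cvgn (series v) -> cvgn (series c).
Proof.
move=> cv v_cvg; have v0 k : 0 <= v k := le_trans (normc_ge0 _) (cv k).
have cR (f : R[i] -> R) : (forall z, `|f z| <= normc z) ->
    cvgn (series (fun k => f (c k))).
  move=> fle; apply: normed_cvg; apply: (series_le_cvg _ v0 _ v_cvg) => k /=.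
    exact: normr_ge0.
  exact: le_trans (fle _) (cv k).
have /cvg_ex[/= x Hx] := cR _ normRe_le.
have /cvg_ex[/= y Hy] := cR _ normIm_le.
apply/cvg_ex; exists (x +i* y)%C; apply: cvgC_normc.
have E N : normc ((x +i* y)%C - series c N) <=
    `|x - series (fun k => complex.Re (c k)) N| +
    `|y - series (fun k => complex.Im (c k)) N|.
  apply: le_trans (normc_le_ReIm _) _; rewrite /series/= !raddfB/= !raddf_sum.
  by [].
apply: (@squeeze_cvgr _ _ _ _ (cst 0) (fun N =>
  `|x - series (fun k => complex.Re (c k)) N| +
  `|y - series (fun k => complex.Im (c k)) N|)).
- by near=> N; rewrite normc_ge0 E.
- exact: cvg_cst.
have lim0 (w : R) (s : nat -> R) : s N @[N --> \oo] --> w ->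
    `|w - s N| @[N --> \oo] --> (0 : R).
  move=> sw; rewrite -(normr0 R) -(subrr w); apply: cvg_norm.
  by apply: cvgB => //; exact: cvg_cst.
by rewrite -[X in _ --> X](addr0 0); apply: cvgD; exact: lim0.
Unshelve. all: by end_near. Qed.

Lemma normc_lim_le (u : nat -> R[i]) (l w : R[i]) (M : R) :
  u n @[n --> \oo] --> l -> (\forall n \near \oo, normc (w - u n) <= M) ->
  normc (w - l) <= M.
Proof.
move=> /normc_cvgC/cvgrPdist_lt ul uM; apply/ler_addgt0Pr => e e0.
near \oo => n.
rewrite (_ : w - l = (w - u n) + (u n - l)); last by ring.
apply: le_trans (normcD _ _) _; apply: lerD; first by near: n.
rewrite normcB ltW//; have : `|0 - normc (l - u n)| < e by near: n; exact: ul.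
by rewrite sub0r normrN ger0_norm// normc_ge0.
Unshelve. all: by end_near. Qed.

Lemma compact_normc_bounded (K : set R[i]) : compact K ->
  exists r : R, forall z, K z -> normc z <= r.
Proof.
move=> cK.
have /compact_bounded[M [_ HM]] : compact (normc @` K).
  apply: continuous_compact => //; apply: continuous_subspaceT => z.
  apply/(@cvgrPdist_le _ _ _ (nbhs z)) => e e0.
  have H0 : normc (z - w) @[w --> z] --> (0 : R).
    exact: (@normc_cvgC _ (nbhs z) _ id z (@cvg_id _ _)).
  move/(@cvgrPdist_lt _ _ _ (nbhs z)): H0 => H0.
  apply: filterS (H0 _ e0) => w; rewrite sub0r normrN [`|normc _|]ger0_norm ?normc_ge0// => H.
  apply: le_trans (ltW H); rewrite ler_norml; apply/andP; split.
    rewrite lerNl opprB lerBlDr normcB; apply: le_trans (normcD _ _).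
    by rewrite subrK.
  by rewrite lerBlDr; apply: le_trans (normcD _ _); rewrite subrK.
exists (M + 1) => z Kz.
have := HM (M + 1) (ltr_pwDr ltr01 (lexx M)) (normc z).
by move=> /(_ (ex_intro2 _ _ z Kz erefl)) /=; rewrite ger0_norm// normc_ge0.
Qed.

(** Uniform convergence on the closed disc of radius [r], with the majorant [d] explicit so that
    sums and products reduce to real limits. *)
Definition ucvg (r : R) (f : nat -> R[i] -> R[i]) (g : R[i] -> R[i]) :=
  exists2 d : nat -> R, d n @[n --> \oo] --> 0 &
    \forall n \near \oo, forall z, normc z <= r -> normc (f n z - g z) <= d n.

Definition normc_bounded (r : R) (g : R[i] -> R[i]) :=
  exists M, forall z, normc z <= r -> normc (g z) <= M.

Lemma ucvgD r f1 f2 g1 g2 : ucvg r f1 g1 -> ucvg r f2 g2 ->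
  ucvg r (fun n z => f1 n z + f2 n z) (fun z => g1 z + g2 z).
Proof.
move=> [d1 c1 H1] [d2 c2 H2]; exists (fun n => d1 n + d2 n).
  by rewrite -[X in _ --> X](addr0 0); exact: cvgD.
near=> n => z zr; rewrite opprD addrACA; apply: le_trans (normcD _ _) _.
by apply: lerD; move: z zr; near: n.
Unshelve. all: by end_near. Qed.

Lemma ucvgM r f1 f2 g1 g2 : normc_bounded r g1 -> normc_bounded r g2 ->
  ucvg r f1 g1 -> ucvg r f2 g2 ->
  ucvg r (fun n z => f1 n z * f2 n z) (fun z => g1 z * g2 z).
Proof.
move=> [M1 B1] [M2 B2] [d1 c1 H1] [d2 c2 H2].
exists (fun n => d1 n * d2 n + d1 n * M2 + M1 * d2 n).
  rewrite [X in _ --> X](_ : 0 = 0 * 0 + 0 * M2 + M1 * 0); last by ring.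
  by apply: cvgD; [apply: cvgD; [exact: cvgM|exact: cvgMl]|exact: cvgMr].
near=> n => z zr.
have /(_ z zr) h1 : forall z, normc z <= r -> normc (f1 n z - g1 z) <= d1 n
  by near: n.
have /(_ z zr) h2 : forall z, normc z <= r -> normc (f2 n z - g2 z) <= d2 n
  by near: n.
(* Expanding around the limits requires bounds on [g1] and [g2] only, not on the approximants. *)
rewrite (_ : _ - _ = (f1 n z - g1 z) * (f2 n z - g2 z) +
  (f1 n z - g1 z) * g2 z + g1 z * (f2 n z - g2 z)); last by ring.
apply: le_trans (normcD _ _) _; rewrite Normc.normcM; apply: lerD; last first.
  by apply: ler_pM; rewrite ?normc_ge0// B1.
apply: le_trans (normcD _ _) _; rewrite !Normc.normcM; apply: lerD.
  by apply: ler_pM; rewrite ?normc_ge0.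
by apply: ler_pM; rewrite ?normc_ge0// B2.
Unshelve. all: by end_near. Qed.

Lemma ucvg_cst r (a : nat -> R) (b : R) : a n @[n --> \oo] --> b ->
  ucvg r (fun n _ => (a n)%:C%C) (fun _ => b%:C%C).
Proof.
move=> ab; exists (fun n => `|a n - b|).
  rewrite -(normr0 R) -(subrr b); apply: cvg_norm.
  by apply: cvgB => //; exact: cvg_cst.
by near=> n => z _; rewrite -rmorphB normc_real.
Unshelve. all: by end_near. Qed.

Lemma ucvg_id r : ucvg r (fun _ z => z) (fun z => z).
Proof.
exists (cst 0); first exact: cvg_cst.
by near=> n => z _; rewrite subrr Normc.normc0.
Unshelve. all: by end_near. Qed.

Lemma ucvg_near r f g h : ucvg r f g ->
  (\forall n \near \oo, forall z, f n z = h n z) -> ucvg r h g.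
Proof.
move=> [d d0 H] fh; exists d => //; near=> n => z zr.
have <- : f n z = h n z by move: z {zr}; near: n.
by move: z zr; near: n.
Unshelve. all: by end_near. Qed.

Lemma normc_bounded_cst r (b : R[i]) : normc_bounded r (fun _ => b).
Proof. by exists (normc b). Qed.

Lemma normc_bounded_id r : normc_bounded r (fun z => z).
Proof. by exists r. Qed.

Lemma normc_boundedM r g1 g2 : normc_bounded r g1 -> normc_bounded r g2 ->
  normc_bounded r (fun z => g1 z * g2 z).
Proof.
move=> [M1 B1] [M2 B2]; exists (M1 * M2) => z zr.
by rewrite Normc.normcM ler_pM ?normc_ge0// ?B1// B2.
Qed.

Lemma ucvg_div r : ucvg r (fun n z => z / n%:R) (fun=> 0).
Proof.
exists (fun n : nat => r / n%:R).
  rewrite -[X in _ --> X](mulr0 r) -cvg_shiftS/=; apply: cvgMr.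
  exact: cvg_harmonic.
near=> n => z zr; rewrite subr0 Normc.normcM Normc.normcV.
rewrite -[n%:R]/(n%:R : R[i]) -(rmorph_nat (real_complex R)) normc_real.
by rewrite normr_nat ler_wpM2r// invr_ge0.
Unshelve. all: by end_near. Qed.

(** Induction along Horner's scheme: the factor [z / n] tends to [0] on the disc, so only the
    constant term survives. *)
Lemma ucvg_ceval_div r (p : {poly R}) :
  ucvg r (fun n z => ceval p (z / n%:R)) (fun=> p.[0]%:C%C).
Proof.
elim/poly_ind: p => [|p c IH].
  rewrite horner0.
  apply: ucvg_near (ucvg_cst r (@cvg_cst _ (0 : R) nat \oo _)) _.
  by near=> n => z; rewrite /ceval map_poly0 horner0.
have H := ucvgM (normc_bounded_cst r _) (normc_bounded_cst r _) IH (ucvg_div r).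
have {}H := ucvgD H (ucvg_cst r (@cvg_cst _ c nat \oo _)).
rewrite hornerMXaddC mulr0 add0r (_ : (fun=> _) =
    fun z : R[i] => (p.[0])%:C%C * 0 + c%:C%C); last first.
  by apply/funext => z; rewrite mulr0 add0r.
apply: ucvg_near (H _) _.
near=> n => z; rewrite /ceval rmorphD rmorphM/= map_polyX map_polyC/=.
by rewrite hornerMXaddC.
Unshelve. all: by end_near. Qed.

Lemma ucvg_uniform (K : set R[i]) r f g : (forall z, K z -> normc z <= r) ->
  ucvg r f g -> {uniform K, f @ \oo --> g}.
Proof.
move=> Kr [d d0 H] P /uniform_nbhs[E [+ EP]].
rewrite -entourage_ballE => -[e /= e0 eE].
have eR : e = (complex.Re e)%:C%C by rewrite RRe_real// gtr0_real.
have e0' : 0 < complex.Re e by rewrite -ltcR -eR.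
near=> n; apply: EP => z Kz; apply: eE => /=.
rewrite -ball_normE/= normr_normc eR ltcR normcB.
have Hn : forall z, normc z <= r -> normc (f n z - g z) <= d n by near: n.
apply: le_lt_trans (Hn z (Kr z Kz)) _.
by near: n; apply: cvgr_lt d0 _ e0'.
Unshelve. all: by end_near. Qed.

End ComplexAnalysis.

(** * The Mehler-Heine limit and the Bessel series *)

Section MehlerHeine.
Context {R : realType}.
Implicit Types z : R[i].
Notation normc := (@Normc.normc R).

Lemma ffact_ratio_ge0 n d k : 0 <= ((n - d) ^_ k)%:R / n%:R ^+ k :> R.
Proof. by rewrite divr_ge0// exprn_ge0. Qed.

Lemma ffact_ratio_le1 n d k : (0 < n)%N ->
  ((n - d) ^_ k)%:R / n%:R ^+ k <= 1 :> R.
Proof.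
move=> n0; rewrite ler_pdivrMr ?exprn_gt0 ?ltr0n// mul1r -natrX ler_nat.
elim: k => [|k IH]; first by rewrite ffactn0.
by rewrite ffactnSr expnSr leq_mul// -subnDA leq_subr.
Qed.

(** Each of the [k] factors falls short of [1] by at most [(d + k) / n], and the deficits add
    because [1 - w v = (1 - w) + w (1 - v)] with [0 <= w <= 1]. *)
Lemma onem_ffact_ratio n d k : (0 < n)%N ->
  1 - ((n - d) ^_ k)%:R / n%:R ^+ k <= (k * (d + k))%:R / n%:R :> R.
Proof.
move=> n0; have n0' : 0 < n%:R :> R by rewrite ltr0n.
have nn0 := lt0r_neq0 n0'.
elim: k => [|k IH]; first by rewrite ffactn0 divr1 subrr mul0n mul0r.
rewrite ffactnSr natrM exprSr.
have := ffact_ratio_ge0 n d k; have := ffact_ratio_le1 d k n0.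
move: IH; have -> : ((n - d) ^_ k)%:R * (n - d - k)%:R / (n%:R ^+ k * n%:R) =
  (((n - d) ^_ k)%:R / n%:R ^+ k) * ((n - d - k)%:R / n%:R) :> R.
  by field; rewrite nn0 expf_neq0.
move: (_ / n%:R ^+ k) => w H w1 w0.
(* This survives truncation of [n - d - k] to [0], as then [n <= d + k]. *)
have u : 1 - (n - d - k)%:R / n%:R <= (d + k)%:R / n%:R :> R.
  rewrite lerBlDr -mulrDl ler_pdivlMr// mul1r -natrD ler_nat -subnDA.
  by rewrite -leq_subLR.
have {}u : w * (1 - (n - d - k)%:R / n%:R) <= (d + k)%:R / n%:R.
  apply: le_trans (_ : w * ((d + k)%:R / n%:R) <= _); first by rewrite ler_wpM2l.
  by rewrite ler_piMl// divr_ge0.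
apply: (@le_trans _ _ ((k * (d + k))%:R / n%:R + (d + k)%:R / n%:R)).
  by apply: le_trans (lerD H u); rewrite mulrBr mulr1 addrA subrK.
rewrite -mulrDl ler_wpM2r ?invr_ge0// -natrD ler_nat.
by rewrite addnC -mulSn leq_mul2l addnS leqnSn orbT.
Qed.

(* Lets [k (d + k) r^k / k!] be summed as an exponential series at [4 r]. *)
Lemma leq_mulD_exp4 d k : (k * (d + k) <= d.+1 * 4 ^ k)%N.
Proof.
have h : (k * k <= 4 ^ k)%N.
  by rewrite (_ : 4 = 2 ^ 2)%N// -expnM mulnC expnM mulnn leq_sqr ltnW// ltn_expl.
rewrite mulnDr mulSn addnC leq_add// mulnC leq_mul//.
by apply: leq_trans h; case: k => // k; rewrite leq_pmulr.
Qed.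

Lemma normr_bessel_coef_le (a : R) k : 0 <= a -> `|bessel_coef a k| <= k`!%:R^-1.
Proof.
move=> a0; have h : 1 <= rising (a + 1) k.
  rewrite /rising; elim: k => [|k IH]; first by rewrite big_ord0.
  by rewrite big_ord_recr/= mulr_ege1// addrAC lerDr addr_ge0.
have f0 : 0 < k`!%:R :> R by rewrite ltr0n fact_gt0.
rewrite /bessel_coef normrM normrX normrN1 expr1n mul1r ger0_norm; last first.
  by rewrite invr_ge0 mulr_ge0// (le_trans _ h).
rewrite lef_pV2 ?posrE// ?mulr_gt0//; last exact: lt_le_trans h.
by rewrite ler_peMr.
Qed.

Lemma series_exp_le (x : R) N : 0 <= x -> \sum_(k < N) x ^+ k / k`!%:R <= expR x.
Proof.
move=> x0; rewrite (_ : \sum_(k < N) _ = series (exp_coeff x) N); last first.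
  by rewrite /series/= big_mkord.
apply: nondecreasing_cvgn_le; last exact: is_cvg_series_exp_coeff.
by apply/nondecreasing_seqP => n; rewrite /series/= big_nat_recr//= lerDl divr_ge0// exprn_ge0.
Qed.

Definition bessel_term (a : R) z (k : nat) : R[i] := (bessel_coef a k)%:C%C * z ^+ k.

(* [Gamma (a + 1) z^(-a/2) J_a(2 sqrt z)] *)
Definition bessel_sum (a : R) z : R[i] := limn (series (bessel_term a z)).

Lemma normc_bessel_term (a : R) z k : 0 <= a ->
  normc (bessel_term a z k) <= normc z ^+ k / k`!%:R.
Proof.
move=> a0; rewrite /bessel_term Normc.normcM normc_real normcX mulrC.
by rewrite ler_wpM2l ?exprn_ge0 ?normc_ge0// normr_bessel_coef_le.
Qed.

Lemma cvg_bessel_sum (a : R) z : 0 <= a ->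
  series (bessel_term a z) N @[N --> \oo] --> bessel_sum a z.
Proof.
move=> a0; apply: (is_cvg_seriesC (v := exp_coeff (normc z))).
  by move=> k; exact: normc_bessel_term.
exact: is_cvg_series_exp_coeff.
Qed.

Lemma normc_bounded_bessel_sum (a r : R) : 0 <= a ->
  normc_bounded r (bessel_sum a).
Proof.
move=> a0; exists (expR r) => z zr; rewrite -normcN -sub0r.
apply: normc_lim_le (@cvg_bessel_sum a z a0) _; near=> N.
rewrite sub0r normcN /series/= big_mkord; apply: le_trans (normc_sum _ _ _) _.
apply: (@le_trans _ _ (expR (normc z))); last by rewrite ler_expR.
apply: le_trans (series_exp_le N (normc_ge0 z)).
by apply: ler_sum => k _; exact: normc_bessel_term.
Unshelve. all: by end_near. Qed.

(** The [k]-th term is that of [bessel_sum] times a weight in [[0, 1]] whose deficit is at most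
    [(d + 1) 4^k / n]. Against [r^k / k!] the deficits sum to [(d + 1) e^(4r) / n], the rate on the
    disc. *)
Lemma ucvg_laguerre_sum (a r : R) d : 0 <= a ->
  ucvg r (fun n z => \sum_(k < (n - d).+1)
      (((n - d) ^_ k)%:R * bessel_coef a k)%:C%C * (z / n%:R) ^+ k)
    (bessel_sum a).
Proof.
move=> a0; exists (fun n : nat => d.+1%:R * expR (4 * r) / n%:R).
  rewrite -[X in _ --> X](mulr0 (d.+1%:R * expR (4 * r))) -cvg_shiftS/=.
  by apply: cvgMr; exact: cvg_harmonic.
near=> n => z zr.
have n0 : (0 < n)%N by near: n; exact: nbhs_infty_gt.
have n0' : 0 < n%:R :> R by rewrite ltr0n.
apply: normc_lim_le (@cvg_bessel_sum a z a0) _; near=> N.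
(* The finite sum, padded with zeros, is compared with a longer partial sum of the Bessel series,
   uniformly in [N]. *)
have nN : ((n - d).+1 <= N)%N by near: N; exact: nbhs_infty_ge.
rewrite (big_ord_widen N (fun k =>
  (((n - d) ^_ k)%:R * bessel_coef a k)%:C%C * (z / n%:R) ^+ k))//.
rewrite /series/= big_mkord big_mkcond/= -sumrB.
apply: le_trans (normc_sum _ _ _) _.
apply: (@le_trans _ _ (\sum_(k < N) d.+1%:R / n%:R * ((4 * normc z) ^+ k / k`!%:R))).
  apply: ler_sum => k _.
  have -> : (if (k < (n - d).+1)%N then
      (((n - d) ^_ k)%:R * bessel_coef a k)%:C%C * (z / n%:R) ^+ k else 0) =
    (((n - d) ^_ k)%:R / n%:R ^+ k : R)%:C%C * bessel_term a z k.
    rewrite ltnS; case: leqP => kn; last by rewrite ffact_small// mul0r mul0r.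
    rewrite /bessel_term expr_div_n -(rmorph_nat (real_complex R)) -rmorphXn/=.
    rewrite [((_ * bessel_coef a k)%:C)%C]rmorphM [((_ / _)%:C)%C]rmorphM fmorphV/=.
    by rewrite [X in _ * X]mulrC mulrACA.
  set w := _ / n%:R ^+ k.
  rewrite (_ : _ - _ = - ((1 - w)%:C%C * bessel_term a z k)); last first.
    by rewrite rmorphB rmorph1; ring.
  rewrite normcN Normc.normcM normc_real ger0_norm; last first.
    by rewrite subr_ge0 ffact_ratio_le1.
  apply: (@le_trans _ _ ((k * (d + k))%:R / n%:R * (normc z ^+ k / k`!%:R))).
    apply: ler_pM; rewrite ?normc_ge0 ?normc_bessel_term//.
      by rewrite subr_ge0 ffact_ratio_le1.
    exact: onem_ffact_ratio.
  rewrite exprMn (_ : d.+1%:R / n%:R * (4 ^+ k * normc z ^+ k / k`!%:R) =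
    (d.+1%:R * 4 ^+ k) / n%:R * (normc z ^+ k / k`!%:R)); last by ring.
  rewrite ler_wpM2r ?divr_ge0 ?exprn_ge0 ?normc_ge0//.
  by rewrite ler_wpM2r ?invr_ge0// -natrX -natrM ler_nat leq_mulD_exp4.
rewrite -mulr_sumr [leRHS]mulrAC ler_wpM2l ?divr_ge0//.
apply: (@le_trans _ _ (expR (4 * normc z))).
  by apply: series_exp_le; rewrite mulr_ge0// normc_ge0.
by rewrite ler_expR ler_wpM2l.
Unshelve. all: by end_near. Qed.

Lemma ucvg_laguerre (a r : R) d : 0 <= a ->
  ucvg r (fun n z => (n%:R `^ (- a))%:C%C * ceval (laguerre a (n - d)) (z / n%:R))
    (fun z => ((Gamma (a + 1))^-1)%:C%C * bessel_sum a z).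
Proof.
move=> a0; have H := ucvgM (normc_bounded_cst r _)
  (normc_bounded_bessel_sum r a0) (ucvg_cst r (@cvg_gbinom _ a d a0))
  (ucvg_laguerre_sum r d a0).
apply: ucvg_near H _; near=> n => z.
by rewrite (ceval_laguerre _ _ (ltnSn _)) ?ltr_wpDl// mulrA -rmorphM.
Unshelve. all: by end_near. Qed.

(** For [-1 < a < 0] the bound [1 / k!] on the coefficients is not at hand, so convergence is drawn
    from the parameters [a + 1] and [a + 2], where it is. *)
Lemma cvg_bessel_recurrence (a : R) z : 0 < a + 1 ->
  series (bessel_term a z) N @[N --> \oo] -->
  bessel_sum (a + 1) z - (((a + 1) * (a + 2))^-1)%:C%C * (z * bessel_sum (a + 2) z).
Proof.
(* The factor [z] shifts the index of the [a + 2] series, so [N + 1] terms on one side meet [N] on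
   the other. *)
move=> a0; rewrite -cvg_shiftS/=.
have E N : series (bessel_term a z) N.+1 =
    series (bessel_term (a + 1) z) N.+1 -
    (((a + 1) * (a + 2))^-1)%:C%C * (z * series (bessel_term (a + 2) z) N).
  rewrite /series/= !big_mkord !big_ord_recl/= -addrA; congr (_ + _).
    by rewrite /bessel_term /bessel_coef /rising !big_ord0.
  rewrite !mulr_sumr -sumrB; apply: eq_bigr => k _; rewrite /bump/= !add1n /bessel_term.
  have -> : bessel_coef a k.+1 = bessel_coef (a + 1) k.+1 -
      ((a + 1) * (a + 2))^-1 * bessel_coef (a + 2) k.
    by rewrite [_^-1 * _]mulrC -bessel_coef_recurrence//; ring.
  rewrite rmorphB/= mulrBl; congr (_ - _).
  rewrite [((_ * bessel_coef (a + 2) k)%:C)%C]rmorphM [z ^+ _.+1]exprS.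
  by rewrite -mulrA; congr (_ * _); rewrite mulrCA.
under eq_fun do rewrite E.
apply: cvgB.
  have H := @cvg_bessel_sum (a + 1) z (ltW a0).
  by rewrite -(cvg_shiftS (series (bessel_term (a + 1) z))) in H.
apply: cvgMr; apply: cvgMr; apply: cvg_bessel_sum.
have -> : a + 2 = a + 1 + 1 by ring.
by rewrite addr_ge0// ltW.
Qed.

Lemma bessel_entireE (a : R) z : 0 < a + 1 ->
  bessel_entire a z = ((Gamma (a + 1))^-1)%:C%C *
   (bessel_sum (a + 1) z - (((a + 1) * (a + 2))^-1)%:C%C * (z * bessel_sum (a + 2) z)).
Proof.
move=> a0; apply: cvg_lim; first exact: norm_hausdorff.
have -> : series (fun k : nat => (-1) ^+ k * z ^+ k / (k`!%:R * (Gamma (k%:R + a + 1))%:C%C))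
    = (fun N => ((Gamma (a + 1))^-1)%:C%C * series (bessel_term a z) N).
  apply/funext => N; rewrite /series/= mulr_sumr; apply: eq_bigr => k _.
  rewrite -addrA Gamma_rising// /bessel_term /bessel_coef.
  rewrite !(rmorphM, fmorphV, rmorphXn, rmorphN1, rmorph_nat)/= !invfM.
  move: (_ ^+ k) (_ ^+ k) (_^-1) (_^-1) (_^-1) => ? ? ? ? ?; ring.
by apply: cvgMr; exact: cvg_bessel_recurrence.
Qed.

End MehlerHeine.

(** * The two Mehler-Heine limits and their collapse by the Bessel recurrence *)

Theorem proposition4p5 (R : realType) (m : nat) (alpha : R)
    (halpha : m%:R - 1 < alpha) (K : set R[i]) (hK : compact K) :
  {uniform K,
    (fun (n : nat) (z : R[i]) =>
       ((n%:R `^ (- alpha - 1))%:C)%C * ceval (xlaguerreII alpha m n) (z / n%:R))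
      @ \oo -->
    (fun z : R[i] =>
       - ((gbinom (m%:R - 1 - alpha) m)%:C)%C * bessel_entire alpha z)}.
Proof.
have a1 : 0 < alpha + 1.
  by rewrite -ltrBlDr sub0r (le_lt_trans _ halpha)// lerBrDr addNr.
have a1' := ltW a1.
have a2 : 0 <= alpha + 2 by rewrite (_ : 2 = 1 + 1)// addrA addr_ge0.
have [r Kr] := compact_normc_bounded hK.
apply: (ucvg_uniform Kr).
pose P := laguerre (- alpha - 1) m; pose Q := laguerre (- alpha - 2) m.
pose B := gbinom (m%:R - 1 - alpha) m.
have bE a : 0 <= a -> normc_bounded r (fun z =>
    ((Gamma (a + 1))^-1)%:C%C * bessel_sum a z).
  move=> a0; apply: normc_boundedM (normc_bounded_cst _ _) _.
  exact: normc_bounded_bessel_sum.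
(* The factor of parameter [alpha + 2] has degree [n - (m + 1)], whence the shift [m.+1]; the other
   one below has shift [m]. *)
have H1 := ucvgM (normc_boundedM (normc_bounded_id r) (normc_bounded_cst r _)) (bE _ a2)
  (ucvgM (normc_bounded_id r) (normc_bounded_cst r _) (ucvg_id r) (ucvg_ceval_div r P))
  (ucvg_laguerre r m.+1 a2).
have H2 := ucvgM (normc_boundedM (normc_bounded_cst r _) (normc_bounded_cst r _)) (bE _ a1')
  (ucvgM (normc_bounded_cst r _) (normc_bounded_cst r _)
     (ucvg_cst r (@cvg_cst _ (m%:R - alpha - 1) nat \oo _)) (ucvg_ceval_div r Q))
  (ucvg_laguerre r m a1').
rewrite (_ : (fun z => - _ * _) = fun z =>
  z * P.[0]%:C%C * (((Gamma (alpha + 2 + 1))^-1)%:C%C * bessel_sum (alpha + 2) z) +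
  (m%:R - alpha - 1)%:C%C * Q.[0]%:C%C *
   (((Gamma (alpha + 1 + 1))^-1)%:C%C * bessel_sum (alpha + 1) z)).
  apply: ucvg_near (ucvgD H1 (H2 _)) _.
  near=> n => z.
  have mn : (m < n)%N by near: n; exact: nbhs_infty_gt.
  have n0 : 0 < n%:R :> R by rewrite ltr0n (leq_ltn_trans _ mn).
  rewrite ceval_xlaguerreII//.
  (* The surplus [n^-1] in the normalisation of the first term is exactly the one in its prefactor
     [z / n]. *)
  have -> : - (alpha + 2) = (- alpha - 1) + (- 1) by ring.
  rewrite [_ `^ (- alpha - 1 - 1)]powRD ?(lt0r_neq0 n0) ?implybT// powR_inv1 ?(ltW n0)//.
  have -> : - (alpha + 1) = - alpha - 1 by ring.
  rewrite [((_ / _)%:C)%C]rmorphM fmorphV rmorph_nat/=.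
  rewrite -/P -/Q.
  move: (ceval _ _) (ceval _ _) (ceval Q _) (ceval P _) => u v q p.
  by move: (n%:R `^ _)%:C%C (_ - _)%:C%C (_^-1) => x y w; ring.
apply/funext => z; rewrite bessel_entireE// !laguerre0.
have -> : m%:R + (- alpha - 1) = m%:R - 1 - alpha by ring.
(* The scalars are now [B] and [- (alpha + 1) B]; writing both Gamma values through
   [Gamma (alpha + 1)] leaves a rational identity. *)
rewrite -[(_ - alpha - 1)%:C%C * _]rmorphM gbinomB1.
have -> : alpha + 2 + 1 = alpha + 1 + 1 + 1 by ring.
rewrite [Gamma (alpha + 1 + 1 + 1)]GammaD1; last by rewrite ltr_wpDr.
rewrite [Gamma (alpha + 1 + 1)]GammaD1//.
have -> : alpha + 1 + 1 = alpha + 2 by ring.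
rewrite -/B; move: B => {}B; move: (Gamma _) (lt0r_neq0 (Gamma_gt0 a1)) => G G0.
move: (alpha + 1) (lt0r_neq0 a1) => s s0.
have : alpha + 2 != 0 by rewrite lt0r_neq0// (_ : 2 = 1 + 1)// addrA ltr_wpDr.
move: (alpha + 2) (bessel_sum _ _) (bessel_sum _ _) => t u v t0.
have C0 (x : R) : x != 0 -> (x%:C)%C != 0 by rewrite fmorph_eq0.
rewrite !(rmorphM, fmorphV, rmorphN)/=.
move: B%:C%C G%:C%C (C0 _ G0) s%:C%C (C0 _ s0) t%:C%C (C0 _ t0).
move=> b g g0 x x0 y y0.
by field; rewrite g0 x0 y0.
Unshelve. all: by end_near. Qed.
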